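(* For any prime $p$ with $p\equiv 1\pmod 4$, $$\sum_{k=0}^{\frac{1}{2}(p-1)}\frac{C_k^{3}}{64^{k}}\equiv 8\pmod{p^2}.$$
   Context: $C_k=\frac{1}{k+1}\binom{2k}{k}$ is the $k$-th Catalan number. The congruence is between rational numbers whose denominators are prime to $p$ (equivalently, it is a congruence in the ring $\mathbb{Z}_p$ of $p$-adic integers). *)

(* Defs.v *)
From mathcomp Require Import all_boot all_order all_algebra.

Set Implicit Arguments.
Unset Strict Implicit.
Unset Printing Implicit Defensive.

Import Order.TTheory GRing.Theory Num.Theory.

Local Open Scope ring_scope.

Definition catalan (k : nat) : rat := 'C(2 * k, k)%:R / k.+1%:R.

(* Membership in Z_(p), i.e. in the intersection of the rationals with the
   p-adic integers; [denq] is the positive denominator in lowest terms. *)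
Definition p_integral (p : nat) (x : rat) : bool := coprime p `|denq x|%N.

(* x = y modulo p ^ n in the ring Z_(p).  The quotient of x - y by p ^ n must
   be p-integral: divisibility in the field of rationals is vacuous. *)
Definition p_cong (p n : nat) (x y : rat) : Prop :=
  [/\ p_integral p x, p_integral p y
    & exists2 z : rat, p_integral p z & x - y = p%:R ^+ n * z].

(* Main.v *)
Require Import Defs.
From mathcomp Require Import all_boot all_order all_algebra.
From mathcomp Require Import ring lra zify.

Set Implicit Arguments.
Unset Strict Implicit.
Unset Printing Implicit Defensive.

Import Order.TTheory GRing.Theory Num.Theory.

Local Open Scope ring_scope.

(* Put n = (p - 1) / 2 and a_k = C(2k,k) / 4^k, so that the summand is
   a_k^3 / (k+1)^3.  Modulo p^2 one has a_k^2 = (-1)^k C(n,k) C(n+k,k), the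
   k-th coefficient of the shifted Legendre polynomial of degree n.  Write
   P(n) and S(n) for the sums over k of these coefficients times a_k and
   times a_k / (k+1)^3.  Creative telescoping gives
     n(n+1) S(n) + 2 = (2n+1)^2 P(n) + (rational in n) P(n-1)
   and a two-step recurrence for P which forces P to vanish at odd arguments.
   As n is even and 2n + 1 = p, the first identity becomes
     S(n) - 8 = p^2 (S(n) - 4 P(n)). *)

(** * Central binomials and Legendre coefficients *)

Definition central (k : nat) : rat := 'C(2 * k, k)%:R / 4%:R ^+ k.

Definition legendre_coef (n k : nat) : rat :=
  (-1) ^+ k * 'C(n, k)%:R * 'C(n + k, k)%:R.

(** This is the terminating series 3F2(-n, n+1, 1/2; 1, 1; 1). *)
Definition legendre_sum (n : nat) : rat :=
  \sum_(0 <= k < n.+1) legendre_coef n k * central k.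

Definition legendre_cube_sum (n : nat) : rat :=
  \sum_(0 <= k < n.+1) legendre_coef n k * central k / k.+1%:R ^+ 3.

Lemma centralS k :
  central k.+1 = central k * ((2 * k%:R + 1) / (2 * (k%:R + 1))).
Proof.
have E : (k.+1 * 'C(2 * k.+1, k.+1) = 2 * (2 * k + 1) * 'C(2 * k, k))%N.
  have := mul_bin_diag (2 * k).+2 k; rewrite [_.+2.-1]/=.
  have := mul_bin_down (2 * k).+1 k; rewrite [_.+1.-1]/=.
  rewrite (_ : (2 * k).+1 - k = k.+1)%N; last by lia.
  rewrite (_ : (2 * k.+1 = (2 * k).+2))%N; last by lia.
  nia.
have k0 : k%:R + 1 != 0 :> rat by rewrite natr1 pnatr_eq0.
have E' : 'C(2 * k.+1, k.+1)%:R =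
    2 * (2 * k%:R + 1) * 'C(2 * k, k)%:R / (k%:R + 1) :> rat.
  apply: (mulfI k0); rewrite natr1 -[LHS]natrM E !natrM natrD natrM -natr1; field.
  by rewrite addrC.
rewrite /central E' exprS; field.
by rewrite k0 expf_neq0.
Qed.

Lemma legendre_coefS n k :
  legendre_coef n k.+1 =
  - (n%:R - k%:R) * (n%:R + k%:R + 1) / (k%:R + 1) ^+ 2 * legendre_coef n k.
Proof.
have k0 : k%:R + 1 != 0 :> rat by rewrite natr1 pnatr_eq0.
have L : (k%:R + 1) * 'C(n, k.+1)%:R = (n%:R - k%:R) * 'C(n, k)%:R :> rat.
  case: (leqP k n) => kn; last by rewrite !bin_small ?mulr0 // ltnW.
  by rewrite natr1 -natrB // -!natrM mul_bin_left.
have D : (k%:R + 1) * 'C(n + k.+1, k.+1)%:R =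
         (n%:R + k%:R + 1) * 'C(n + k, k)%:R :> rat.
  by rewrite -natrD !natr1 -!natrM addnS mul_bin_diag.
apply: (mulfI (expf_neq0 2 k0)).
rewrite /legendre_coef [_ ^+ k.+1]exprS.
transitivity (- (-1) ^+ k * ((k%:R + 1) * 'C(n, k.+1)%:R) *
              ((k%:R + 1) * 'C(n + k.+1, k.+1)%:R) : rat); first by ring.
by rewrite L D; field.
Qed.

(** Kept free of division because n + 1 - k vanishes at k = n + 1, where the coefficient of degree n
    + 1 does not. *)
Lemma legendre_coef_degS n k :
  (n%:R + 1 - k%:R) * legendre_coef n.+1 k =
  (n%:R + 1 + k%:R) * legendre_coef n k.
Proof.
have n0 : n%:R + 1 != 0 :> rat by rewrite natr1 pnatr_eq0.
have L : (n%:R + 1 - k%:R) * 'C(n.+1, k)%:R = (n%:R + 1) * 'C(n, k)%:R :> rat.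
  case: (leqP k n.+1) => kn; last by rewrite !bin_small ?mulr0 // ltnW.
  by rewrite natr1 -natrB // -!natrM mul_bin_down.
have D : (n%:R + 1) * 'C(n.+1 + k, k)%:R =
         (n%:R + 1 + k%:R) * 'C(n + k, k)%:R :> rat.
  rewrite natr1 -natrD -!natrM mul_bin_down addSn.
  by congr ((_ * _)%:R); lia.
apply: (mulfI n0); rewrite /legendre_coef.
transitivity ((-1) ^+ k * ((n%:R + 1 - k%:R) * 'C(n.+1, k)%:R) *
              ((n%:R + 1) * 'C(n.+1 + k, k)%:R) : rat); first by ring.
by rewrite L D; ring.
Qed.

Lemma legendre_coef0 n : legendre_coef n 0 = 1.
Proof. by rewrite /legendre_coef !bin0 !mulr1. Qed.

Lemma legendre_coef_small n k : (n < k)%N -> legendre_coef n k = 0.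
Proof. by move=> nk; rewrite /legendre_coef bin_small // mulr0 mul0r. Qed.

(** * Creative telescoping for the two sums *)

Lemma legendre_sum_widen n m : (n < m)%N ->
  legendre_sum n = \sum_(0 <= k < m) legendre_coef n k * central k.
Proof.
move=> nm; rewrite [RHS](big_cat_nat (leq0n n.+1) nm) /= -/(legendre_sum n).
rewrite [X in _ + X]big1_seq ?addr0 // => k; rewrite mem_index_iota.
by case/andP=> _ /andP[nk _]; rewrite legendre_coef_small ?mul0r.
Qed.

Lemma legendre_sum_rec n :
  (n%:R + 2) ^+ 2 * legendre_sum n.+2 = (n%:R + 1) ^+ 2 * legendre_sum n.
Proof.
(* [d] is a common factor of the coefficients of degrees n, n+1 and n+2, used
   because they vanish from different k on; [g] is Zeilberger's certificate. *)
pose d k : rat := legendre_coef n.+2 k / ((n%:R + 1 + k%:R) * (n%:R + 2 + k%:R)).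
pose g k : rat := - 2 * (2 * n%:R + 3) * k%:R ^+ 3 * d k * central k.
have nk0 m k : n%:R + m.+1%:R + k%:R != 0 :> rat.
  by rewrite -!natrD pnatr_eq0 addnS.
apply/eqP; rewrite -subr_eq0 (@legendre_sum_widen n n.+3) ?ltnS ?leqW //.
rewrite (@legendre_sum_widen n.+2 n.+3) // !mulr_sumr -sumrB.
rewrite (telescope_sumr_eq g) //; last first.
  move=> k _.
  have n_ge0 : 0 <= n%:R :> rat by []. have k_ge0 : 0 <= k%:R :> rat by [].
  have n1 := nk0 0%N k; have n2 := nk0 1%N k; have n3 := nk0 2%N k.
  have k0 : k%:R + 1 != 0 :> rat by rewrite natr1 pnatr_eq0.
  have c2 : legendre_coef n.+2 k = (n%:R + 1 + k%:R) * (n%:R + 2 + k%:R) * d k.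
    by rewrite /d; field; rewrite n1 n2.
  have c1 : legendre_coef n.+1 k = (n%:R + 2 - k%:R) * (n%:R + 1 + k%:R) * d k.
    apply: (mulfI n2).
    have := legendre_coef_degS n.+1 k.
    rewrite c2 -natr1 -[n%:R + 1 + 1]addrA (_ : 1 + 1 = 2) // => <-; ring.
  have c0 : legendre_coef n k = (n%:R + 1 - k%:R) * (n%:R + 2 - k%:R) * d k.
    apply: (mulfI n1).
    have := legendre_coef_degS n k; rewrite c1 => <-; ring.
  have d1 : d k.+1 = - (n%:R + 1 + k%:R) * (n%:R + 2 - k%:R)
                     / (k%:R + 1) ^+ 2 * d k.
    rewrite {1}/d legendre_coefS c2 -!natr1; field.
    by repeat (apply/andP; split); apply: lt0r_neq0; lra.
  rewrite /g d1 centralS c0 c2 -natr1; field.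
  exact: k0.
(* Both ends vanish: the upper one lies beyond degree n + 2, the lower one has the factor k^3. *)
by rewrite /g /d legendre_coef_small // !(mul0r, mulr0, expr0n, subrr).
Qed.

(** Steps of two lead down to degree 1, where the sum is 1 - 2/2. Conceptually, [central k] is the
    k-th moment of the arcsine law on [0,1], which is symmetric about 1/2, while shifted Legendre
    polynomials of odd degree are antisymmetric there. *)
Lemma legendre_sum_odd n : odd n -> legendre_sum n = 0.
Proof.
elim/ltn_ind: n => -[|[|n]] IHn //= on.
  by rewrite /legendre_sum !big_nat_recl // big_geq.
have n0 : n%:R + 2 != 0 :> rat by rewrite -natrD pnatr_eq0 addn2.
apply: (mulfI (expf_neq0 2 n0)); rewrite legendre_sum_rec IHn ?mulr0 //.
by rewrite negbK in on.
Qed.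

Lemma legendre_cube_sum_rec n (m : rat := n%:R + 1)
    (u : rat := m * (4 * (m + 1) ^+ 2 + 2 * (m + 1) + 1) / (m + 1) ^+ 2) :
  m * (m + 1) * legendre_cube_sum n.+1 + 2 =
  (2 * m + 1) ^+ 2 * legendre_sum n.+1
  + (1 + 4 * m * (m + 1) - u) * legendre_sum n.
Proof.
(* [u] and [v] solve the linear system that makes [g] telescope. *)
pose v := u * m + 1 - (1 + 4 * m * (m + 1) - u).
(* Divide by [legendre_coef n.+1 k * central k]. The constant term m and the values of u and v
   reduce the pole of [g k.+1] at k = -1 to m(m+1)/(k+1)^3; v also matches the pole of [g k] at k =
   -m with that of the degree n term. *)
pose q k : rat := u * k%:R ^+ 2 + v * k%:R + m.
pose g k : rat := 2 * legendre_coef n.+1 k * central k * q k / (m + k%:R).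
have mk0 k : m + k%:R != 0 by rewrite /m natr1 -natrD pnatr_eq0.
have m1 : m + 1 != 0 by have := mk0 1%N.
(* The upper end of the telescope vanishes, so this value is the source of the constant 2. *)
have g0 : g 0%N = 2.
  rewrite /g /q legendre_coef0 /central bin0; field.
  by have := mk0 0%N; rewrite addr0.
suff E : m * (m + 1) * legendre_cube_sum n.+1
    - (2 * m + 1) ^+ 2 * legendre_sum n.+1
    - (1 + 4 * m * (m + 1) - u) * legendre_sum n = - 2.
  by apply: subr0_eq; rewrite -(subrr (- 2)) -{1}E; ring.
rewrite (@legendre_sum_widen n n.+2) // /legendre_cube_sum /legendre_sum.
rewrite !mulr_sumr -!sumrB.
rewrite (telescope_sumr_eq g) //; last first.
  move=> k _.
  have k0 : k%:R + 1 != 0 :> rat by rewrite natr1 pnatr_eq0.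
  have mk := mk0 k; have mk1 := mk0 k.+1.
  have c0 : legendre_coef n k = (m - k%:R) * legendre_coef n.+1 k / (m + k%:R).
    by rewrite legendre_coef_degS -/m; field.
  move: mk1; rewrite /g /q /v /u legendre_coefS centralS c0 -!natr1 -/m => mk1.
  field.
  by rewrite k0 m1 mk mk1.
by rewrite g0 /g legendre_coef_small //; ring.
Qed.

(** * Closure properties of p-integral rationals *)

(** The reduced denominator divides any other by Gauss's lemma, so any denominator prime to p will
    do; closure under sums and products then only multiplies denominators. *)
Lemma p_integralP p x : reflect
  (exists2 d : nat, coprime p d & x * d%:R \is a Num.int) (p_integral p x).
Proof.
apply: (iffP idP) => [px | [d pd /intrP[m xdm]]].
  exists `|denq x|%N => //.
  by rewrite pmulrn gtz0_abs ?denq_gt0 // -numqE intr_int.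
apply: coprime_dvdr pd.
have : (numq x * d = m * denq x)%R.
  apply: (@intr_inj rat); rewrite !intrM numqE -xdm -pmulrn; ring.
move/(congr1 (fun z : int => `|z|%N)); rewrite !abszM /= => nd.
have : (`|denq x| %| `|numq x| * d)%N by rewrite nd dvdn_mull.
by rewrite Gauss_dvdr // coprime_sym coprime_num_den.
Qed.

Lemma coprime_prime_lt p k : prime p -> (0 < k < p)%N -> coprime p k.
Proof.
by move=> pp /andP[k0 kp]; rewrite prime_coprime // gtnNdvd.
Qed.

Lemma p_integral_nat p n : p_integral p n%:R.
Proof. by apply/p_integralP; exists 1%N; rewrite ?coprimen1 ?mulr1 ?natr_int. Qed.

Lemma p_integralN p x : p_integral p x -> p_integral p (- x).
Proof.
by case/p_integralP=> d pd xd; apply/p_integralP; exists d; rewrite // mulNr rpredN.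
Qed.

Lemma p_integralM p x y :
  p_integral p x -> p_integral p y -> p_integral p (x * y).
Proof.
case/p_integralP=> d pd xd /p_integralP[e pe ye].
apply/p_integralP; exists (d * e)%N; first by rewrite coprimeMr pd.
by rewrite natrM mulrACA rpredM.
Qed.

Lemma p_integralD p x y :
  p_integral p x -> p_integral p y -> p_integral p (x + y).
Proof.
case/p_integralP=> d pd xd /p_integralP[e pe ye].
apply/p_integralP; exists (d * e)%N; first by rewrite coprimeMr pd.
by rewrite natrM mulrDl mulrA [y * _]mulrCA; apply: rpredD; apply: rpredM; rewrite ?natr_int.
Qed.

Lemma p_integralX p x k : p_integral p x -> p_integral p (x ^+ k).
Proof.
move=> px; elim: k => [|k IHk]; first exact: (p_integral_nat p 1).
by rewrite exprS p_integralM.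
Qed.

Lemma p_integralV p n : coprime p n -> p_integral p n%:R^-1.
Proof.
move=> pn; apply/p_integralP; exists n => //.
(* The case n = 0 is compatible with coprimality when p = 1. *)
by have [->|n0] := eqVneq (n%:R : rat) 0; rewrite ?mulr0 ?mulVf ?rpred0 ?rpred1.
Qed.

Lemma p_integral_sum p (I : eqType) (r : seq I) (F : I -> rat) :
  {in r, forall i, p_integral p (F i)} -> p_integral p (\sum_(i <- r) F i).
Proof.
move=> pF; rewrite big_seq; elim/big_rec: _ => [|i x ri px].
  exact: (p_integral_nat p 0).
by rewrite p_integralD ?pF.
Qed.

(** * The congruences modulo p^2 *)

Lemma p_integral_central p k : odd p -> p_integral p (central k).
Proof.
move=> op; rewrite /central -natrX; apply: p_integralM (p_integral_nat _ _) _.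
by apply/p_integralV/coprimeXr/(@coprimeXr 2 p 2); rewrite coprimen2.
Qed.

Lemma p_integral_legendre_coef p n k : p_integral p (legendre_coef n k).
Proof.
rewrite /legendre_coef !p_integralM ?p_integral_nat // p_integralX //.
exact/p_integralN/(p_integral_nat p 1).
Qed.

(* (-1)^k C(n,k) C(n+k,k) is the product of ((2j-1)^2 - p^2) / (4 j^2), and
   the square of C(2k,k)/4^k that of (2j-1)^2 / (4 j^2), over 1 <= j <= k. *)
Lemma central_sqr_mod p n k (hp : prime p) (pn : p = (2 * n).+1) :
  (k <= n)%N ->
  exists2 e : rat, p_integral p e &
    central k ^+ 2 - legendre_coef n k = p%:R ^+ 2 * e.
Proof.
have op : odd p by rewrite pn /= mul2n odd_double.
elim: k => [_ | k IHk kn].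
  exists 0; first exact: (p_integral_nat p 0).
  by rewrite legendre_coef0 /central bin0 expr0 divr1 expr1n subrr mulr0.
have [e pe De] := IHk (ltnW kn).
have pk : p_integral p (2 * k.+1)%:R^-1.
  apply: p_integralV; rewrite coprimeMr coprimen2 op.
  by apply: coprime_prime_lt => //; lia.
(* The two new factors differ by p^2 / (2(k+1))^2, which multiplies [legendre_coef n k]; the old
   error is scaled by (2k+1)^2 / (2(k+1))^2. *)
exists ((e * (2 * k + 1)%:R ^+ 2 + legendre_coef n k) * (2 * k.+1)%:R^-1 ^+ 2).
  apply: p_integralM (p_integralX _ pk); apply: p_integralD.
    by apply: p_integralM (p_integralX _ (p_integral_nat _ _)).
  exact: p_integral_legendre_coef.
have Dc : central k ^+ 2 = legendre_coef n k + p%:R ^+ 2 * e by rewrite -De; ring.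
rewrite centralS exprMn Dc legendre_coefS pn natrM natrD natrM -!natr1 natrM.
field; by rewrite natr1 pnatr_eq0.
Qed.

Theorem mainTheorem2 (p : nat) (hp : prime p) (hp4 : p = 1 %[mod 4]) :
  p_cong p 2
    (\sum_(0 <= k < ((p - 1) %/ 2).+1) catalan k ^+ 3 / 64%:R ^+ k)
    8%:R.
Proof.
have p1 := prime_gt1 hp.
have [m pE] : exists m, p = (4 * m.+1).+1 by exists (p %/ 4).-1; lia.
(* From here (p - 1)/2 is n + 1 and n is odd, to fit the indexing of [legendre_cube_sum_rec]. *)
pose n := (2 * m).+1.
have pn : p = (2 * n.+1).+1 by lia.
have op : odd p by lia.
have -> : ((p - 1) %/ 2)%N = n.+1 by lia.
have pk k : (k <= n.+1)%N -> p_integral p k.+1%:R^-1.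
  by move=> kn; apply/p_integralV/coprime_prime_lt => //; lia.
have Dcat k : catalan k ^+ 3 / 64%:R ^+ k = central k ^+ 3 / k.+1%:R ^+ 3.
  by rewrite /catalan /central !expr_div_n -exprM [(k * 3)%N]mulnC exprM -natrX [LHS]mulrAC.
under eq_bigr => k _ do rewrite Dcat.
set Q := \sum_(_ <= _ < _) _.
have pS : p_integral p (legendre_cube_sum n.+1).
  apply: p_integral_sum => k; rewrite mem_index_iota ltnS => kn.
  rewrite -exprVn; apply: p_integralM (p_integralX _ (pk _ kn)).
  by apply: p_integralM; [exact: p_integral_legendre_coef|exact: p_integral_central].
have pP : p_integral p (legendre_sum n.+1).
  apply: p_integral_sum => k _.
  by apply: p_integralM; [exact: p_integral_legendre_coef|exact: p_integral_central].
have [z pz Dz] : exists2 z : rat,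
    p_integral p z & Q - legendre_cube_sum n.+1 = p%:R ^+ 2 * z.
  (* Dividing in the rationals gives one formula for all the error terms; [central_sqr_mod] then
     shows each to be p-integral. *)
  pose e k : rat := (central k ^+ 2 - legendre_coef n.+1 k) / p%:R ^+ 2.
  have p0 : p%:R != 0 :> rat by rewrite pnatr_eq0; lia.
  exists (\sum_(0 <= k < n.+2) e k * central k / k.+1%:R ^+ 3).
    apply: p_integral_sum => k; rewrite mem_index_iota ltnS => /= kn.
    have [x px Dx] := central_sqr_mod hp pn kn.
    rewrite -exprVn; apply: p_integralM (p_integralX _ (pk _ kn)).
    apply: p_integralM (p_integral_central _ op).
    by rewrite /e Dx mulrC mulKf ?expf_neq0.
  rewrite /Q /legendre_cube_sum -sumrB mulr_sumr.
  apply: eq_bigr => k _; rewrite /e; field.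
  by rewrite p0 nat1r pnatr_eq0.
have S8 : legendre_cube_sum n.+1 - 8 =
    p%:R ^+ 2 * (legendre_cube_sum n.+1 - 4 * legendre_sum n.+1).
  have := legendre_cube_sum_rec n.
  rewrite (@legendre_sum_odd n) /= ?mul2n ?odd_double // mulr0 addr0 => E.
  have -> : p%:R = 2 * (n%:R + 1) + 1 :> rat by rewrite pn -natr1 natrM natr1.
  (* As (n+1)(n+2) = (p^2 - 1)/4, four times [E] reads (p^2 - 1) S + 8 = 4 p^2 P, with S and P taken
     at n + 1. *)
  move: E; lra.
have p_4P : p_integral p (legendre_cube_sum n.+1 - 4 * legendre_sum n.+1).
  by apply: p_integralD => //; apply/p_integralN/p_integralM/pP/p_integral_nat.
have QE : Q - 8 =
    p%:R ^+ 2 * (z + (legendre_cube_sum n.+1 - 4 * legendre_sum n.+1)).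
  by rewrite mulrDr -Dz -S8; ring.
split; last 1 first.
- by eexists; last exact: QE; apply: p_integralD.
- rewrite -(subrK 8 Q) QE; apply: p_integralD (p_integral_nat p 8).
  by apply: p_integralM (p_integralD _ _) => //; exact/p_integralX/p_integral_nat.
- exact: p_integral_nat.
Qed.
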